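(* Assume Schanuel's conjecture. Let $\lambda,\mu\in\bar{\mathbb{Q}}$ be such that $1,\lambda,\mu$ are linearly independent over $\mathbb{Q}$, and let $\mathcal{F}(x,y)=\ln x+\lambda\ln y+\mu\ln(x+y-1)$. Then the integral $$I_{10}=\int_{\mathcal{F}(x,y)=h}\frac{yx+y^2-y}{\lambda x+\lambda y+\mu y-\lambda}\,dx$$ has no telescoper.
   Context: Here $y=y(x,h)$ is defined by $\mathcal{F}(x,y(x,h))=h$, so $\partial_x y=F(x,y)$ with $F=-\partial_x\mathcal{F}/\partial_y\mathcal{F}$, and $\partial_h y=1/U(x,y)$ with $U=\partial_y\mathcal{F}=\frac{\lambda}{y}+\frac{\mu}{x+y-1}$ (a rational integrating factor). $I_{10}(x,h)$ is an antiderivative in $x$ of $G(x,y(x,h))$ with $G=\frac{yx+y^2-y}{\lambda x+\lambda y+\mu y-\lambda}$, defined up to addition of an arbitrary function of $h$. A telescoper for $I_{10}$ is an identity $L\,I_{10}=H(x,y(x,h))$ with $0\neq L\in\mathbb{C}[\partial_h]$ (constant coefficients) and $H\in\mathbb{C}(x,y)$, holding for a suitable choice of the additive function of $h$ in $I_{10}$. Equivalently, writing $D_x=\partial_x+F\partial_y$ and $D_h=U^{-1}\partial_y$, there are $0\ne\sum_i a_iT^i\in\mathbb{C}[T]$ and $H\in\mathbb{C}(x,y)$ with $D_xH=\sum_i a_iD_h^iG$. Schanuel's conjecture: if $z_1,\dots,z_n\in\mathbb{C}$ are linearly independent over $\mathbb{Q}$, then $\mathbb{Q}(z_1,\dots,z_n,e^{z_1},\dots,e^{z_n})$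 has transcendence degree at least $n$ over $\mathbb{Q}$. *)

(* Defs.v *)
From HB Require Import structures.
From mathcomp Require Import all_boot all_order all_algebra.
From mathcomp Require Import generic_quotient fraction polyXY.
From mathcomp Require Import all_real_closed.
From mathcomp Require Import reals sequences exp trigo ring.
From mathcomp Require Import -(notations) mpoly.

Set Implicit Arguments.
Unset Strict Implicit.
Unset Printing Implicit Defensive.

Import GRing.Theory Num.Theory.

Local Open Scope ring_scope.

(* C is R[i] for R : realType, with the usual complex exponential. *)
Definition cexp (R : realType) (z : R[i]) : R[i] :=
  ((expR (complex.Re z))%:C * (cos (complex.Im z) +i* sin (complex.Im z)))%C.

Definition algebraic_number (R : realType) (z : R[i]) : Prop :=
  algebraicOver (ratr : rat -> R[i]) z.

Definition lin_indepQ (R : realType) n (z : n.-tuple R[i]) : Prop :=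
  forall q : 'I_n -> rat,
    \sum_(i < n) ratr (q i) * tnth z i = 0 -> forall i, q i = 0.

Definition alg_indepQ (R : realType) n (z : n.-tuple R[i]) : Prop :=
  forall p : mpoly n rat,
    mmap (ratr : rat -> R[i]) (tnth z) p = 0 -> p = 0.

(* w belongs to Q(s), the smallest subfield of C containing s. *)
Definition in_Q_adjoin (R : realType) (s : seq R[i]) (w : R[i]) : Prop :=
  forall K : {pred R[i]},
    GRing.divring_closed K -> {subset s <= K} -> w \in K.

Definition trdegQ_ge (R : realType) (s : seq R[i]) (n : nat) : Prop :=
  exists t : n.-tuple R[i],
    alg_indepQ t /\ forall i : 'I_n, in_Q_adjoin s (tnth t i).

Definition schanuel_conjecture (R : realType) : Prop :=
  forall (n : nat) (z : n.-tuple R[i]),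
    lin_indepQ z -> trdegQ_ge (z ++ map (@cexp R) z) n.

Local Notation "x %:F" := (@FracField.tofrac _ x) : ring_scope.

(* C(x, y) is the fraction field of C[y][x]: x is the outer variable 'X and
   y is the inner one, 'Y = 'X%:P. *)
Notation ratfun R := {fraction {poly {poly R[i]}}}.

Definition cst (R : realType) (c : R[i]) : ratfun R :=
  (c%:P%:P)%:F.
Definition fx (R : realType) : ratfun R := 'X%:F.
Definition fy (R : realType) : ratfun R := 'Y%:F.

(* Extension of a derivation d of A to Frac A by the quotient rule, computed
   on the chosen representative n/d; frac_deriv_div below shows that the value
   does not depend on the representative. *)
Definition frac_deriv (A : idomainType) (d : A -> A) (f : {fraction A}) :
    {fraction A} :=
  let r := repr f in
  (d \n_r * \d_r - \n_r * d \d_r)%:F / (\d_r)%:F ^+ 2.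

Lemma repr_numden (A : idomainType) (f : {fraction A}) :
  f * (\d_(repr f))%:F = (\n_(repr f))%:F.
Proof.
rewrite -{1}[f]reprK.
move: (repr f) => r; rewrite -[LHS]/(FracField.mul _ _) !piE.
apply/eqmodP; rewrite /= FracField.equivfE /FracField.mulf.
by rewrite !numden_Ratio ?mulf_neq0 ?oner_neq0 ?denom_ratioP // !mulr1 mulrC.
Qed.

Lemma frac_deriv_div (A : idomainType) (d : A -> A) :
    (forall a b, d (a * b) = d a * b + a * d b) ->
  forall a b : A, b != 0 ->
  frac_deriv d (a%:F / b%:F) = (d a * b - a * d b)%:F / b%:F ^+ 2.
Proof.
move=> dM a b b0; rewrite /frac_deriv /=.
have := repr_numden (a%:F / b%:F); have := denom_ratioP (repr (a%:F / b%:F)).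
move: (\n_(repr _)) (\d_(repr _)) => n m m0 fE.
have E : a * m = n * b.
  apply/eqP; rewrite -tofrac_eq !tofracM; apply/eqP.
  by rewrite -fE mulrAC divfK ?tofrac_eq0.
have E' : d a * m + a * d m = d n * b + n * d b by rewrite -!dM E.
apply/eqP; rewrite eqr_div ?expf_neq0 ?tofrac_eq0 // -!tofracXn -!tofracM.
rewrite tofrac_eq -subr_eq0; apply/eqP.
have -> : (d n * m - n * d m) * b ^+ 2 - (d a * b - a * d b) * m ^+ 2 =
  (d n * b + n * d b - (d a * m + a * d m)) * (m * b)
  - (n * b - a * m) * (d m * b + d b * m) by ring.
by rewrite E' E !subrr !mul0r subr0.
Qed.

Definition dx (R : realType) : ratfun R -> ratfun R :=
  frac_deriv (fun p : {poly {poly R[i]}} => p^`()).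
Definition dy (R : realType) : ratfun R -> ratfun R :=
  frac_deriv (map_poly (fun q : {poly R[i]} => q^`())).

(* The multivalued function sum_k c_k ln f_k is encoded by the list of the
   pairs (c_k, f_k); only its derivatives sum_k c_k (d f_k) / f_k, which are
   rational functions, are ever used. *)
Definition log_comb (R : realType) := seq (R[i] * ratfun R).

Definition dlog (R : realType) (d : ratfun R -> ratfun R) (f : log_comb R) :
    ratfun R :=
  \sum_(t <- f) cst t.1 * (d t.2 / t.2).

(* On a branch y(x, h) of f(x, y) = h, one has d/dx y = slope and
   d/dh y = 1 / int_factor, so that Dx and Dh below are the derivatives with
   respect to x and h of P(x, y(x, h)), for P in C(x, y). *)
Definition slope (R : realType) (f : log_comb R) : ratfun R :=
  - dlog (@dx R) f / dlog (@dy R) f.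

Definition int_factor (R : realType) (f : log_comb R) : ratfun R :=
  dlog (@dy R) f.

Definition Dx (R : realType) (f : log_comb R) (P : ratfun R) : ratfun R :=
  dx P + slope f * dy P.

Definition Dh (R : realType) (f : log_comb R) (P : ratfun R) : ratfun R :=
  (int_factor f)^-1 * dy P.

(* The integral I of G dx along f(x, y) = h has a telescoper L = a(d/dh), with
   certificate H: after differentiation in x, which absorbs the choice of the
   additive function of h in I, L I = H(x, y(x, h)) reads Dx H = a(Dh) G. *)
Definition has_telescoper (R : realType) (f : log_comb R) (G : ratfun R) :
    Prop :=
  exists (a : {poly R[i]}) (H : ratfun R),
    a != 0 /\ Dx f H = \sum_(i < size a) cst a`_i * iter i (Dh f) G.

Definition F10 (R : realType) (lambda mu : R[i]) : log_comb R :=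
  [:: (1, fx R); (lambda, fy R); (mu, fx R + fy R - 1)].

Definition G10 (R : realType) (lambda mu : R[i]) : ratfun R :=
  let x := fx R in let y := fy R in
  let l := cst lambda in let m := cst mu in
  (y * x + y ^+ 2 - y) / (l * x + l * y + m * y - l).

(* Main.v *)
Require Import Defs.
From HB Require Import structures.
From mathcomp Require Import all_boot all_order all_algebra.
From mathcomp Require Import generic_quotient fraction polyXY.
From mathcomp Require Import all_real_closed reals ring.

(* In the coordinates x and u = y / (1 - x) the multivalued function separates:
   F = ln x + c ln (1 - x) + lambda ln u + mu ln (u - 1) up to a constant, with
   c = lambda + mu. With g = lambda / u + mu / (u - 1) and theta = g^-1 d/du on
   k = C(u), the derivation D_h becomes theta, the integrand (which is 1 / U)
   becomes (1 - x) / g, and a telescoper a(T) with certificate H reads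
     H_x - (1 / x - c / (1 - x)) theta H = (1 - x) a(theta) g^-1.
   Choose an integer N > 0 with a(N) <> 0 and expand H in powers of x over k.
   Modulo the image of theta - N the operator theta is multiplication by N; the
   coefficients of H / (1 - x)^2 then satisfy a first order scalar recurrence
   whose multiplier of the n-th coefficient is N - n. It vanishes exactly at
   n = N, while the other multipliers do not vanish because c is irrational.
   Hence a(N) / g, and so 1 / g, lies in the image of theta - N, that is
   v' - N g v = 1 for some v in C(u). The poles and the degree of v rule this
   out since N lambda, N mu and N (lambda + mu) are not integers. *)

Set Implicit Arguments.
Unset Strict Implicit.
Unset Printing Implicit Defensive.

Import GRing.Theory Num.Theory.

Local Open Scope ring_scope.

Local Notation "x %:F" := (@FracField.tofrac _ x) : ring_scope.

(** * Derivations and fraction fields *)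

(* Derivations are taken along a morphism f, so that the composites of a
   derivation and a ring morphism, in either order, are covered. *)
Record derivation (A B : comNzRingType) (f d : A -> B) : Prop := Derivation {
  derivation_add : forall a b, d (a + b) = d a + d b;
  derivation_mul : forall a b, d (a * b) = d a * f b + f a * d b }.

Section DerivationTheory.
Variables (A B : comNzRingType) (f : {rmorphism A -> B}) (d : A -> B).
Hypothesis dP : derivation f d.

Lemma derivation0 : d 0 = 0.
Proof. by apply: (addrI (d 0)); rewrite -(derivation_add dP) !addr0. Qed.

Lemma derivationN a : d (- a) = - d a.
Proof. by apply: (addrI (d a)); rewrite -(derivation_add dP) !subrr derivation0. Qed.

Lemma derivationB a b : d (a - b) = d a - d b.
Proof. by rewrite (derivation_add dP) derivationN. Qed.

Lemma derivation1 : d 1 = 0.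
Proof.
apply: (addrI (d 1)); rewrite addr0 -{3}[1]mulr1 (derivation_mul dP).
by rewrite rmorph1 mulr1 mul1r.
Qed.

Lemma derivation_sum I (r : seq I) (F : I -> A) :
  d (\sum_(i <- r) F i) = \sum_(i <- r) d (F i).
Proof. exact: (big_morph d (derivation_add dP) derivation0). Qed.

Lemma derivationX a n : d (a ^+ n) = f a ^+ n.-1 * d a *+ n.
Proof.
elim: n => [|[|n] IH]; first by rewrite expr0 derivation1 mulr0n.
  by rewrite !expr1 expr0 mul1r.
rewrite exprS (derivation_mul dP) IH /= rmorphXn /= [in RHS]mulrS exprS; ring.
Qed.

End DerivationTheory.

Lemma derivation_comp_l (A B : comNzRingType) (f : {rmorphism A -> B})
    (d : B -> B) : derivation idfun d -> derivation f (d \o f).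
Proof. by case=> dD dM; split=> a b /=; rewrite ?rmorphD ?rmorphM. Qed.

Lemma derivation_comp_r (A B : comNzRingType) (f : {rmorphism A -> B})
    (d : A -> A) : derivation idfun d -> derivation f (f \o d).
Proof. by case=> dD dM; split=> a b /=; rewrite ?dD ?dM ?rmorphD ?rmorphM. Qed.

Lemma derivation_scale_add (A B : comNzRingType) (f d e : A -> B) (b : B) :
  derivation f d -> derivation f e ->
  derivation f (fun a => d a + b * e a).
Proof. by case=> dD dM [eD eM]; split=> a a'; rewrite ?dD ?eD ?dM ?eM; ring. Qed.

Lemma derivation_scale (A B : comNzRingType) (f d : A -> B) (b : B) :
  derivation f d -> derivation f (fun a => b * d a).
Proof. by case=> dD dM; split=> a a'; rewrite ?dD ?dM; ring. Qed.

Lemma deriv_derivation (A : comNzRingType) :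
  derivation idfun (fun p : {poly A} => p^`()).
Proof. by split=> p q; rewrite ?derivD ?derivM. Qed.

Lemma map_poly_derivation (A : comNzRingType) (d : A -> A) :
  derivation idfun d -> derivation idfun (map_poly d).
Proof.
move=> dP; have d0 := derivation0 dP; case: (dP) => dD dM; split=> p q.
  by apply/polyP=> i; rewrite coefD !coef_map_id0 // coefD dD.
apply/polyP=> i; rewrite coefD !coef_map_id0 // !coefM.
rewrite (derivation_sum dP) -big_split /=; apply: eq_bigr => j _.
by rewrite dM !coef_map_id0.
Qed.

Lemma poly_derivation_eq (A B : comNzRingType) (f : {rmorphism {poly A} -> B})
    (d e : {poly A} -> B) :
  derivation f d -> derivation f e -> (forall a, d a%:P = e a%:P) ->
  d 'X = e 'X -> d =1 e.
Proof.
move=> dP eP dC dX; elim/poly_ind => [|p a IH].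
  by rewrite (derivation0 dP) (derivation0 eP).
rewrite (derivation_add dP) (derivation_add eP).
by rewrite (derivation_mul dP) (derivation_mul eP) dC dX IH.
Qed.

(** The primed letters stand for the derivatives of numerators and denominators, so that additivity
    and the Leibniz rule on fractions become plain field identities. *)
Fact quotient_rule_add (L : fieldType) (a b p q a' b' p' q' : L) :
  b != 0 -> q != 0 ->
  ((a' * q + a * q' + (p' * b + p * b')) * (b * q)
   - (a * q + p * b) * (b' * q + b * q')) / (b * q) ^+ 2 =
  (a' * b - a * b') / b ^+ 2 + (p' * q - p * q') / q ^+ 2.
Proof. by move=> b0 q0; field; rewrite b0 q0. Qed.

Fact quotient_rule_mul (L : fieldType) (a b p q a' b' p' q' : L) :
  b != 0 -> q != 0 ->
  ((a' * p + a * p') * (b * q) - a * p * (b' * q + b * q')) / (b * q) ^+ 2 =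
  (a' * b - a * b') / b ^+ 2 * (p / q) + a / b * ((p' * q - p * q') / q ^+ 2).
Proof. by move=> b0 q0; field; rewrite b0 q0. Qed.

Section FracDeriv.
Variables (A : idomainType) (d : A -> A).
Hypothesis dP : derivation idfun d.

Lemma frac_deriv_tofrac a : frac_deriv d a%:F = (d a)%:F.
Proof.
rewrite -[a%:F]divr1 -tofrac1 frac_deriv_div ?oner_neq0 //; last exact: derivation_mul dP.
by rewrite (derivation1 dP) mulr0 subr0 mulr1 tofrac1 expr1n divr1.
Qed.

Lemma fracP (f : {fraction A}) : exists a b : A, b != 0 /\ f = a%:F / b%:F.
Proof.
exists (\n_(repr f)), (\d_(repr f)); rewrite denom_ratioP; split=> //.
by rewrite -repr_numden mulfK // tofrac_eq0 denom_ratioP.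
Qed.

Lemma frac_deriv_derivation : derivation idfun (frac_deriv d).
Proof.
have dM := derivation_mul dP; split=> f g.
all: have [a [b [b0 ->]]] := fracP f; have [p [q [q0 ->]]] := fracP g.
all: have b0' : b%:F != 0 :> {fraction A} by rewrite tofrac_eq0.
all: have q0' : q%:F != 0 :> {fraction A} by rewrite tofrac_eq0.
  rewrite addf_div // -!tofracM -tofracD !frac_deriv_div ?mulf_neq0 //.
  rewrite !(derivation_add dP) !dM !(tofracD, tofracN, tofracM) /=.
  exact: quotient_rule_add.
rewrite mulf_div -!tofracM !frac_deriv_div ?mulf_neq0 //.
rewrite !dM !(tofracD, tofracN, tofracM) /=.
exact: quotient_rule_mul.
Qed.

End FracDeriv.

(** From x b = a the Leibniz rule forces the value at x, since [f b%:F] is invertible. *)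
Lemma frac_derivation_eq (A : idomainType) (L : fieldType)
    (f : {rmorphism {fraction A} -> L}) (d e : {fraction A} -> L) :
  derivation f d -> derivation f e -> (forall a, d a%:F = e a%:F) -> d =1 e.
Proof.
move=> dP eP de x; have [a [b [b0 ->]]] := fracP x.
have b0' : b%:F != 0 :> {fraction A} by rewrite tofrac_eq0.
have fb0 : f b%:F != 0 by rewrite fmorph_eq0.
apply: (mulIf fb0); apply: (addIr (f (a%:F / b%:F) * d b%:F)).
by rewrite -(derivation_mul dP) [in RHS]de -(derivation_mul eP) divfK // de.
Qed.

Section FracLift.
Variables (A : idomainType) (L : fieldType) (f : {rmorphism A -> L}).
Hypothesis f_inj : injective f.

(** The proof of injectivity is a parameter so that the ring morphism instances below, which depend
    on it, can be attached to this term. Independence of the representative is [frac_lift_div]. *)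
Definition frac_lift of injective f := fun x : {fraction A} =>
  f (\n_(repr x)) / f (\d_(repr x)).

Local Notation g := (frac_lift f_inj).

Let f_neq0 a : a != 0 -> f a != 0.
Proof. by move=> a0; rewrite -(rmorph0 f) (inj_eq f_inj). Qed.

Lemma frac_lift_div a b : b != 0 -> g (a%:F / b%:F) = f a / f b.
Proof.
move=> b0; rewrite /frac_lift.
have := repr_numden (a%:F / b%:F); have := denom_ratioP (repr (a%:F / b%:F)).
move: (\n_(repr _)) (\d_(repr _)) => n m m0 E.
apply/eqP; rewrite eqr_div ?f_neq0 // -!rmorphM; apply/eqP; congr (f _).
apply/eqP; rewrite -tofrac_eq !tofracM -E mulrAC divfK ?tofrac_eq0 //.
Qed.

Lemma frac_lift_tofrac a : g a%:F = f a.
Proof. by rewrite -[a%:F]divr1 -tofrac1 frac_lift_div ?oner_neq0 // rmorph1 divr1. Qed.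

Lemma frac_lift_zmod_morphism : zmod_morphism g.
Proof.
move=> x y; have [a [b [b0 ->]]] := fracP x; have [p [q [q0 ->]]] := fracP y.
rewrite -mulNr -tofracN addf_div ?tofrac_eq0 // -!tofracM -tofracD.
rewrite !frac_lift_div ?mulf_neq0 // !(rmorphD, rmorphM, rmorphN) /=.
by rewrite -[- (_ / _)]mulNr addf_div ?f_neq0.
Qed.

Lemma frac_lift_monoid_morphism : monoid_morphism g.
Proof.
split=> [|x y]; first by rewrite -tofrac1 frac_lift_tofrac rmorph1.
have [a [b [b0 ->]]] := fracP x; have [p [q [q0 ->]]] := fracP y.
rewrite mulf_div -!tofracM !frac_lift_div ?mulf_neq0 // !rmorphM.
by rewrite mulf_div.
Qed.

HB.instance Definition _ :=
  GRing.isZmodMorphism.Build {fraction A} L g frac_lift_zmod_morphism.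
HB.instance Definition _ :=
  GRing.isMonoidMorphism.Build {fraction A} L g frac_lift_monoid_morphism.

End FracLift.

(** * A first order equation without rational solutions *)

(** Here t is X - r, and the last parenthesis of the hypothesis is q' expanded, with c = k + 1.
    After division by t^k, the term c p s is the only one in the bracket that t does not divide. *)
Fact pole_cancel (A : idomainType) (t u v p q s p' s' c : A) k :
  t != 0 -> q = s * t ^+ k.+1 ->
  u * q ^+ 2 =
    u * (p' * q - p * (s' * t ^+ k.+1 + s * (c * t ^+ k))) - v * p * q ->
  u * s ^+ 2 * (t * t ^+ k.+1) =
    u * (p' * s * t - p * s' * t - c * p * s) - v * p * s * t.
Proof.
move=> t0 ->; rewrite !(exprS t) => E; apply: (mulIf (expf_neq0 k t0)).
move: E; move: (t ^+ k) => r E.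
transitivity (u * (s * (t * r)) ^+ 2); first by ring.
by rewrite E; ring.
Qed.

Fact horner1 (A : comNzRingType) (x : A) : (1 : {poly A}).[x] = 1.
Proof. by rewrite -polyC1 hornerC. Qed.

Definition horner_simp :=
  (horner1, hornerD, hornerN, hornerM, hornerX, hornerC, horner_exp).

Section RationalODE.
Variables (F : numClosedFieldType) (a b : F).
Hypothesis a_nint : forall n : nat, a + n%:R != 0.
Hypothesis b_nint : forall n : nat, b + n%:R != 0.
Hypothesis ab_nint : forall n : nat, a + b != n%:R.

(** The quotient of [l] by [w] is a / X + b / (X - 1), the coefficient of the equation v' - (l / w)
    v = 1. *)
Local Notation w := ('X * ('X - 1) : {poly F}).
Local Notation l := (a%:P * ('X - 1) + b%:P * 'X : {poly F}).

(** Let v = p / q have a pole of order k + 1 at r. Away from 0 and 1 nothing cancels the pole of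
    order k + 2 of v'. At 0 and 1 the leading polar coefficient is multiplied by a + k + 1 or b + k
    + 1 up to sign, which is nonzero. *)
Lemma rational_ode_poles (p q : {poly F}) : q != 0 -> coprimep p q ->
  w * q ^+ 2 = w * (p^`() * q - p * q^`()) - l * p * q ->
  size q = 1.
Proof.
move=> q0 cpq E; apply/eqP; apply: contraT => /closed_rootP [r qr].
have pr : p.[r] != 0.
  by apply: contraL qr => pr; rewrite rootE (Pdiv.CommonIdomain.coprimep_root cpq).
have [[|k] [s]] := multiplicity_XsubC q r; rewrite q0 /= rootE => sr qE.
  by move: qr; rewrite qE expr0 mulr1 rootE (negPf sr).
have k0 : k.+1%:R != 0 :> F by rewrite pnatr_eq0.
have [t tE] : exists t, t = 'X - r%:P by exists ('X - r%:P).
rewrite -tE in qE.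
have t0 : t != 0 by rewrite tE polyXsubC_eq0.
have tr : t.[r] = 0 by rewrite tE !horner_simp subrr.
have dq : q^`() = s^`() * t ^+ k.+1 + s * ((k.+1%:R)%:P * t ^+ k).
  by rewrite qE derivM deriv_exp {2}tE derivXsubC mul1r polyC_natr -mulr_natl.
rewrite {}dq in E; have {}E := pole_cancel t0 qE E.
(* At r only r (r - 1) (k + 1) p(r) s(r) = 0 survives, so r is 0 or 1. *)
have := f_equal2 horner E (erefl r); rewrite !horner_simp tr !(mul0r, mulr0, subr0, sub0r, oppr0).
move => /esym/eqP; rewrite mulrN oppr_eq0 !mulf_eq0 (negPf pr) (negPf sr).
rewrite (negPf k0) !orbF subr_eq0 => /orP[]/eqP r01.
  have tX : t = 'X by rewrite tE r01 subr0.
  (* For r = 0 the factor [w] vanishes too; one more division by X is needed before evaluation says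
     anything. *)
  have {}E : ('X - 1) * s ^+ 2 * ('X * 'X ^+ k.+1) =
      ('X - 1) * (p^`() * s * 'X - p * s^`() * 'X - (k.+1%:R)%:P * p * s) - l * p * s.
    apply: (mulIf (negbT (polyX_eq0 F))); rewrite -!tX in E *.
    by transitivity (t * (t - 1) * s ^+ 2 * (t * t ^+ k.+1)); [ring|rewrite E; ring].
  have := f_equal2 horner E (erefl r); rewrite !horner_simp r01.
  rewrite !(mul0r, mulr0, subr0, addr0, sub0r, oppr0).
  move=> /esym/eqP.
  have -> : -1 * - (k.+1%:R * p.[0] * s.[0]) - a * -1 * p.[0] * s.[0] =
    (a + k.+1%:R) * p.[0] * s.[0] by ring.
  by rewrite r01 in pr sr; rewrite !mulf_eq0 (negPf (a_nint _)) (negPf pr) (negPf sr).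
have tX : t = 'X - 1 by rewrite tE r01.
have {}E : 'X * s ^+ 2 * (t * t ^+ k.+1) =
    'X * (p^`() * s * t - p * s^`() * t - (k.+1%:R)%:P * p * s) - l * p * s.
  apply: (mulIf t0); rewrite -!tX in E *.
  by transitivity ('X * t * s ^+ 2 * (t * t ^+ k.+1)); [ring|rewrite E; ring].
have := f_equal2 horner E (erefl r); rewrite !horner_simp tr r01 subrr.
rewrite !(mul0r, mulr0, subr0, addr0, sub0r, add0r, oppr0).
move=> /esym/eqP.
have -> : 1 * - (k.+1%:R * p.[1] * s.[1]) - b * 1 * p.[1] * s.[1] =
    - ((b + k.+1%:R) * p.[1] * s.[1]) by ring.
rewrite r01 in pr sr.
by rewrite oppr_eq0 !mulf_eq0 (negPf (b_nint _)) (negPf pr) (negPf sr).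
Qed.


(** Once q is constant, p vanishes at 0 and 1, where [l] takes the nonzero values -a and b; hence p
    = w r. If n = deg r, the coefficient of degree n + 1 of the equation for r is n + 2 - (a + b)
    times the leading coefficient of r, which cannot vanish. *)
Lemma rational_ode_poly (p q : {poly F}) : q != 0 -> coprimep p q ->
  w * q ^+ 2 != w * (p^`() * q - p * q^`()) - l * p * q.
Proof.
move=> q0 cpq; apply/eqP => E.
have /eqP := rational_ode_poles q0 cpq E.
move=> /size_poly1P [c c0 qE]; rewrite {}qE in E.
have [p_0 p_1] : p.[0] = 0 /\ p.[1] = 0.
  have a0 : a != 0 by move: (a_nint 0); rewrite addr0.
  have b0 : b != 0 by move: (b_nint 0); rewrite addr0.
  split; apply/eqP.
    have := f_equal2 horner E (erefl 0); rewrite !horner_simp.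
    rewrite !(mulr0, mul0r, subr0, addr0, sub0r, add0r, oppr0) => /esym/eqP.
    by rewrite oppr_eq0 !mulf_eq0 !oppr_eq0 (negPf a0) oner_eq0 (negPf c0) orbF.
  have := f_equal2 horner E (erefl 1); rewrite !horner_simp subrr.
  rewrite !(mulr0, mul0r, subr0, addr0, sub0r, add0r, oppr0) => /esym/eqP.
  by rewrite oppr_eq0 !mulf_eq0 oner_eq0 (negPf b0) (negPf c0) /= orbF.
have [r pE] : exists r, p = w * r.
  have /factor_theorem [p1 p1E] : root p 0 by apply/eqP.
  have /factor_theorem [r rE] : root p1 1.
    by move/eqP: p_1; rewrite p1E !horner_simp subr0 mulr1.
  by exists r; rewrite p1E rE subr0; ring.
have w0 : w != 0 by rewrite mulf_neq0 ?polyX_eq0 // -[1]/(1%:P) polyXsubC_eq0.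
have cP0 : c%:P != 0 :> {poly F} by rewrite polyC_eq0.
have {}E : c%:P = (2%:R * 'X - 1) * r + w * r^`() - l * r.
  apply: (mulIf cP0); apply: (mulfI w0); move: E.
  rewrite pE derivC !derivM derivB derivX -polyC1 derivC polyC1.
  move=> E; transitivity (w * c%:P ^+ 2); first by ring.
  by rewrite E; ring.
have r0 : r != 0.
  by apply: contraNneq cP0 => r0; rewrite E r0 deriv0 !mulr0 addr0 subr0.
have [n [rn rn1]] : exists n, r`_n != 0 /\ r`_n.+1 = 0.
  exists (size r).-1; rewrite -lead_coefE lead_coef_eq0 r0.
  by rewrite prednK ?size_poly_gt0 // nth_default.
have := congr1 (fun p : {poly F} => p`_n.+1) E; rewrite coefC /=.
(* In degree n + 1 the second group only yields multiples of the coefficient of degree n + 1 of r,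
   which is 0. *)
have -> : (2%:R * 'X - 1) * r + w * r^`() - l * r =
  'X * ((2%:R - (a + b)%:P) * r + 'X * r^`()) + ((a%:P - 1) * r - 'X * r^`()).
  by rewrite polyCD; ring.
rewrite -polyC1 -polyC_natr -!polyCB !(coefD, coefN, coefXM, coefCM) /= rn1.
have -> : (if n == 0 then 0 else r^`()`_n.-1) = n%:R * r`_n.
  by case: (n) => [|i]; rewrite ?mul0r // coef_deriv mulr_natl.
rewrite coef_deriv rn1 mul0rn mulr0 oppr0 !addr0 -mulrDl => /esym/eqP.
rewrite mulf_eq0 (negPf rn) orbF addrAC subr_eq0 -natrD eq_sym.
by rewrite (negPf (ab_nint _)).
Qed.

Fact clear_denominators (L : fieldType) (x y p q e c d : L) :
  x != 0 -> y != 0 -> q != 0 ->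
  e / q ^+ 2 - (c / x + d / y) * (p / q) = 1 ->
  x * y * q ^+ 2 = x * y * e - (c * y + d * x) * p * q.
Proof.
move=> x0 y0 q0 E; rewrite -[LHS]mulr1 -E; field; by rewrite x0 y0 q0.
Qed.

Lemma rational_ode (v : {fraction {poly F}}) :
  frac_deriv (@deriv F) v
  - (a%:P%:F / 'X%:F + b%:P%:F / ('X%:F - 1)) * v != 1.
Proof.
apply/eqP => E.
have [p0 [q0 [q0_neq0 vE]]] := fracP v.
have d0 : gcdp p0 q0 != 0 by rewrite gcdp_eq0 (negPf q0_neq0) andbF.
(* The pole analysis needs v in lowest terms. *)
have cpq : coprimep (p0 %/ gcdp p0 q0) (q0 %/ gcdp p0 q0).
  by apply: coprimep_div_gcd; rewrite q0_neq0 orbT.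
have q_neq0 : q0 %/ gcdp p0 q0 != 0 by rewrite dvdp_div_eq0 ?dvdp_gcdr.
have {}vE : v = (p0 %/ gcdp p0 q0)%:F / (q0 %/ gcdp p0 q0)%:F.
  apply/eqP; rewrite vE eqr_div ?tofrac_eq0 // -!tofracM tofrac_eq.
  apply/eqP; rewrite -[X in X * _ = _](divpK (dvdp_gcdl p0 q0)).
  by rewrite -[X in _ = _ * X](divpK (dvdp_gcdr p0 q0)); ring.
move: (p0 %/ _) (q0 %/ _) cpq q_neq0 vE => p q cpq q_neq0 vE.
move: E; rewrite vE frac_deriv_div //; last by move=> *; rewrite derivM.
have x0 : 'X%:F != 0 :> {fraction {poly F}} by rewrite tofrac_eq0 polyX_eq0.
have y0 : 'X%:F - 1 != 0 :> {fraction {poly F}}.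
  by rewrite -tofrac1 -tofracB tofrac_eq0 -polyC1 polyXsubC_eq0.
have q0' : q%:F != 0 :> {fraction {poly F}} by rewrite tofrac_eq0.
move/(clear_denominators x0 y0 q0') => /eqP.
rewrite -tofrac1 -tofracB -!tofracM -tofracD -tofracXn -!tofracM -tofracB.
by rewrite tofrac_eq; apply/negP; exact: rational_ode_poly.
Qed.

End RationalODE.

(** * Expansion in powers of x *)

Section Recurrence.
Variables (k : fieldType) (theta : k -> k).
Hypothesis thetaP : derivation idfun theta.

Lemma derivation_nat n : theta n%:R = 0.
Proof.
elim: n => [|n IH]; first exact: (derivation0 thetaP).
by rewrite -natr1 (derivation_add thetaP) IH (derivation1 thetaP) addr0.
Qed.

(** The image of theta - r, a space over the constants of theta; modulo it theta acts as
    multiplication by r. *)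
Definition twisted_exact (r f : k) := exists v, f = theta v - r * v.

Lemma twisted_exactD r f g :
  twisted_exact r f -> twisted_exact r g -> twisted_exact r (f + g).
Proof.
by case=> v -> [w ->]; exists (v + w); rewrite (derivation_add thetaP); ring.
Qed.

Lemma twisted_exactZ r a f : theta a = 0 ->
  twisted_exact r f -> twisted_exact r (a * f).
Proof.
move=> a0 [v ->]; exists (a * v); rewrite (derivation_mul thetaP) a0 /=; ring.
Qed.

Lemma twisted_exactZ_inv r a f : theta a = 0 -> a != 0 ->
  twisted_exact r (a * f) -> twisted_exact r f.
Proof.
move=> a0 an0 [v vE]; exists (a^-1 * v).
have /(congr1 theta) := mulVf an0; rewrite (derivation1 thetaP).
rewrite (derivation_mul thetaP) a0 mulr0 addr0 => /eqP.
rewrite mulf_eq0 (negPf an0) orbF => /eqP ai0.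
rewrite (derivation_mul thetaP) ai0 mul0r add0r /= mulrCA -mulrBr -vE.
by rewrite mulKf.
Qed.

(** S is the power series of P / Q modulo X^M: Q is invertible there because its constant term is
    nonzero. *)
Lemma series_truncation (P Q : {poly k}) M : Q.[0] != 0 ->
  exists S T : {poly k}, P = Q * S + 'X^M * T.
Proof.
move=> Q0.
have /Bezout_eq1_coprimepP [[u v] /= E] : coprimep Q 'X^M.
  by rewrite coprimep_expr // coprimepX rootE.
exists (u * P), (v * P).
rewrite -[LHS]mul1r -E; ring.
Qed.

(** The hypothesis is X a h' + b h + c theta(h) = r for h = P / Q, multiplied by Q^2. Since d/dx
    occurs with a factor X, and X (X^M)' is again a multiple of X^M, truncating h at order M loses
    no order in the equation. *)
Lemma truncated_solution (P Q a b c r : {poly k}) M : Q.[0] != 0 ->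
  'X * a * (P^`() * Q - P * Q^`()) + b * P * Q
  + c * (map_poly theta P * Q - P * map_poly theta Q) = r * Q ^+ 2 ->
  exists S : {poly k}, forall j, (j < M)%N ->
    ('X * a * S^`() + b * S + c * map_poly theta S)`_j = r`_j.
Proof.
move=> Q0 E; have [S [T PE]] := series_truncation P M Q0; exists S.
have mP := map_poly_derivation thetaP.
have dX : map_poly theta 'X^M = 0.
  apply/polyP=> j; rewrite coef_map_id0 ?(derivation0 thetaP) // coefXn coef0.
  by rewrite derivation_nat.
have XD : 'X * 'X^M^`() = M%:R * 'X^M :> {poly k}.
  case: M {PE dX} => [|M]; first by rewrite expr0 derivC mulr0 mul0r.
  by rewrite derivXn mulrnAr -exprS mulr_natl.
have : 'X^M %| ('X * a * S^`() + b * S + c * map_poly theta S - r) * Q ^+ 2.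
  rewrite mulrBl -E PE !derivD !derivM.
  rewrite !(derivation_add mP) !(derivation_mul mP) dX /=.
  (* The witness gathers the terms in T left after P is replaced by Q S + X^M T. *)
  apply/dvdpP; exists (- (a * ((M%:R * T + 'X * T^`()) * Q - T * ('X * Q^`()))
    + b * T * Q + c * (map_poly theta T * Q - T * map_poly theta Q))).
  apply/eqP; rewrite -subr_eq0; apply/eqP.
  transitivity (a * T * Q * (M%:R * 'X^M - 'X * 'X^M^`())); first by ring.
  by rewrite XD subrr mulr0.
rewrite Gauss_dvdpl; last first.
  by rewrite coprimep_expl // coprimep_expr // coprimep_sym coprimepX rootE.
case/dvdpP => D DE j jM; apply/eqP; rewrite -subr_eq0 -coefB DE coefMXn.
by rewrite jM.
Qed.

(* With s the coefficients of P / Q and n = j - m, the coefficient of X^j gives,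
   modulo the image of theta - N,
     (n - N) s_j + ((1 + c) N - (n + 1)) s_(j-1) = R if n = 1, and 0 otherwise.
   So s_j vanishes for n <= 0 by increasing induction, (N - n) s_j vanishes for
   1 <= n <= N by decreasing induction, and n = 1 yields R. *)
Lemma obstruction (P Q : {poly k}) (c R : k) (m N : nat) :
  theta c = 0 -> Q.[0] != 0 -> (0 < N)%N ->
  (forall n : nat, n.+1%:R != 0 :> k) ->
  (forall n : nat, (1 + c) * N%:R != n%:R) ->
  'X * (1 - 'X) * (P^`() * Q - P * Q^`())
  + (- m%:R - (2%:R - m%:R) * 'X) * P * Q
  + (- (1 - (1 + c%:P) * 'X)) * (map_poly theta P * Q - P * map_poly theta Q)
  = (R%:P * 'X^(m.+1)) * Q ^+ 2 ->
  twisted_exact N%:R R.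
Proof.
move=> c0 Q0 N0 char0 cN E.
(* Order m + N + 1 keeps the coefficients up to j = m + N, that is n = N, where the multiplier N - n
   vanishes. *)
have [S SE] := truncated_solution (m + N).+1 Q0 E.
pose s j := S`_j.
have theta0 := derivation0 thetaP.
have Xderiv j : ('X * S^`())`_j = j%:R * s j.
  by rewrite coefXM; case: j => [|j]; rewrite ?mul0r // coef_deriv mulr_natl.
have opE : 'X * (1 - 'X) * S^`() + (- m%:R - (2%:R - m%:R) * 'X) * S
    + (- (1 - (1 + c%:P) * 'X)) * map_poly theta S =
  'X * S^`() - m%:R%:P * S - map_poly theta S
  - 'X * ('X * S^`() + (2%:R - m%:R)%:P * S - (1 + c)%:P * map_poly theta S).
  by rewrite !(polyCB, polyCD, polyC_natr); ring.
have rec0 : m%:R * s 0 + theta (s 0) = 0.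
  have := SE 0 (ltn0Sn _); rewrite opE coefCM coefXn mulr0 !(coefB, Xderiv).
  rewrite coefXM coefCM coef_map_id0 // mul0r sub0r subr0 -opprD => /eqP.
  by rewrite oppr_eq0 => /eqP.
have rec j : (j < m + N)%N ->
  j.+1%:R * s j.+1 - m%:R * s j.+1 - theta (s j.+1)
  - (j%:R * s j + (2%:R - m%:R) * s j - (1 + c) * theta (s j)) = R *+ (j == m).
  move=> jM; have := SE j.+1 jM; rewrite opE coefCM coefXn eqSS mulr_natr => <-.
  rewrite !(coefB, Xderiv) coefXM /= coefB coefD Xderiv !coefCM.
  by rewrite !coef_map_id0.
have thetaB := derivationB thetaP; have thetaM := derivation_mul thetaP.
have thetaD := derivation_add thetaP; have theta1 := derivation1 thetaP.
have exact_rec j : (j < m + N)%N -> twisted_exact N%:R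
    ((j.+1%:R - m%:R - N%:R) * s j.+1
     + ((1 + c) * N%:R - (j%:R + 2%:R - m%:R)) * s j - R *+ (j == m)).
  (* The witness gathers the two arguments of theta in [rec]; subtracting N times it replaces theta
     by N there. *)
  move=> jM; exists (s j.+1 - (1 + c) * s j); rewrite -(rec j jM).
  by rewrite thetaB thetaM thetaD theta1 c0 /=; ring.
have natN n : theta (- n%:R) = 0.
  by rewrite (derivationN thetaP) derivation_nat oppr0.
have nat0 n : (0 < n)%N -> n%:R != 0 :> k by case: n.
have below j : (j <= m)%N -> twisted_exact N%:R (s j).
  elim: j => [_|j IH jm].
    apply: (@twisted_exactZ_inv _ (- (m + N)%:R)); rewrite ?natN //.
      by rewrite oppr_eq0 nat0 // addn_gt0 N0 orbT.
    by exists (s 0); rewrite natrD -[theta _](addKr (m%:R * s 0)) rec0; ring.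
  apply: (@twisted_exactZ_inv _ (- (m - j.+1 + N)%:R)); rewrite ?natN //.
    by rewrite oppr_eq0 nat0 // addn_gt0 N0 orbT.
  have -> : - (m - j.+1 + N)%:R * s j.+1 =
      ((j.+1%:R - m%:R - N%:R) * s j.+1
       + ((1 + c) * N%:R - (j%:R + 2%:R - m%:R)) * s j - R *+ (j == m))
      + (- ((1 + c) * N%:R - (j%:R + 2%:R - m%:R))) * s j.
    by rewrite (ltn_eqF jm) natrD natrB // mulr0n; ring.
  apply: twisted_exactD; first by apply: exact_rec; rewrite ltn_addr.
  apply: twisted_exactZ; last exact: IH (ltnW jm).
  rewrite (derivationN thetaP) thetaB thetaM thetaD theta1 c0 thetaB thetaD.
  by rewrite !derivation_nat /=; ring.
(* Descending from n = N: here n = N - i, so i is the multiplier N - n. The start i = 0 is free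
   because the multiplier is 0. *)
have above i : (i < N)%N -> twisted_exact N%:R (i%:R * s (m + N - i)%N).
  elim: i => [_|i IH iN].
    by rewrite mul0r; exists 0; rewrite theta0 mulr0 subrr.
  apply: twisted_exactZ; first exact: derivation_nat.
  have [j jE] : exists j, (m + N - i)%N = j.+1.
    by exists (m + N - i).-1; rewrite prednK // subn_gt0 ltn_addl // ltnW.
  have jN : (j + i).+1 = (m + N)%N.
    by rewrite -addSn -jE subnK // (leq_trans (ltnW (ltnW iN))) // leq_addl.
  have jm : (m < j)%N.
    by rewrite -(leq_add2r i.+1) [(j + _)%N]addnS jN addSnnS leq_add2l.
  have -> : (m + N - i.+1)%N = j by rewrite subnS jE.
  (* Since j > m, the subtracted quantity is the natural number j + 2 - m, which (1 + c) N
     avoids. *)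
  have cn : (1 + c) * N%:R - (j%:R + 2%:R - m%:R) != 0.
    rewrite subr_eq0 -natrD -natrB ?cN // ltnW // ltn_addr //.
  apply: (@twisted_exactZ_inv _ _ _ _ cn).
    rewrite thetaB thetaM thetaD theta1 c0 thetaB thetaD.
    by rewrite !derivation_nat /=; ring.
  have -> : ((1 + c) * N%:R - (j%:R + 2%:R - m%:R)) * s j =
      ((j.+1%:R - m%:R - N%:R) * s j.+1
       + ((1 + c) * N%:R - (j%:R + 2%:R - m%:R)) * s j - R *+ (j == m))
      + i%:R * s j.+1.
    rewrite (gtn_eqF jm) mulr0n subr0.
    have -> : i%:R = m%:R + N%:R - j.+1%:R :> k.
      by rewrite -natrD -jN -addSn natrD addrC addKr.
    ring.
  apply: twisted_exactD; first by apply: exact_rec; rewrite -jN ltnS leq_addr.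
  by rewrite -jE; apply: IH; exact: ltnW.
(* At j = m the multiplier of the coefficient with n = 1 is 1 - N, cancelled by [above] at i = N -
   1; the other coefficient is covered by [below]. *)
have -> : R = - (((m.+1%:R - m%:R - N%:R) * s m.+1
     + ((1 + c) * N%:R - (m%:R + 2%:R - m%:R)) * s m - R *+ (m == m))
     + (N.-1%:R * s m.+1
     + (- ((1 + c) * N%:R - (m%:R + 2%:R - m%:R))) * s m)).
  by rewrite eqxx mulr1n -[in N%:R](prednK N0) -[N.-1.+1]addn1 -[m.+1]addn1 !natrD; ring.
rewrite -mulN1r; apply: twisted_exactZ.
  by rewrite (derivationN thetaP) theta1 oppr0.
apply: twisted_exactD; first by apply: exact_rec; rewrite -addn1 leq_add2l.
apply: twisted_exactD.
  have := above N.-1; rewrite prednK // leqnn => /(_ isT).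
  have -> // : (m + N - N.-1)%N = m.+1.
  by rewrite -{1}(prednK N0) addnS -addSn addnK.
apply: twisted_exactZ; last exact: below.
rewrite (derivationN thetaP) thetaB thetaM thetaD theta1 c0 thetaB thetaD.
by rewrite !derivation_nat /=; ring.
Qed.
End Recurrence.

(** * The change of variables *)

Lemma iter_twisted_exact (k : fieldType) (theta : k -> k) (r f : k) i :
  derivation idfun theta -> theta r = 0 ->
  twisted_exact theta r (iter i theta f - r ^+ i * f).
Proof.
move=> thetaP r0; elim: i => [|i IH /=].
  by rewrite mul1r subrr; exists 0; rewrite (derivation0 thetaP) mulr0 subrr.
have -> : theta (iter i theta f) - r ^+ i.+1 * f =
    (theta (iter i theta f) - r * iter i theta f)
    + r * (iter i theta f - r ^+ i * f) by rewrite exprS; ring.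
apply: (twisted_exactD thetaP); first by exists (iter i theta f).
exact: (twisted_exactZ thetaP).
Qed.

(** The integers from 1 to [size a] are too many to be all roots of a. *)
Lemma exists_nat_nonroot (F : numDomainType) (a : {poly F}) : a != 0 ->
  exists2 N : nat, (0 < N)%N & a.[N%:R] != 0.
Proof.
move=> a0; pose s := [seq i%:R : F | i <- iota 1 (size a)].
have [/(max_poly_roots a0)|/allPn [_ /mapP [N NE ->] Nr]] := boolP (all (root a) s).
  rewrite size_map size_iota ltnn map_inj_uniq ?iota_uniq; last first.
    by move=> i j /eqP; rewrite eqr_nat => /eqP.
  by move=> /(_ isT).
by move: NE; rewrite mem_iota => /andP [N0 _]; exists N.
Qed.

Section Straightening.
Variable F : idomainType.
Local Notation k := {fraction {poly F}}.
Local Notation K := {fraction {poly {poly F}}}.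
Local Notation L := {fraction {poly k}}.

(* Substitution of u (1 - x) for y, where u = 'X%:F generates k over F; swapXY
   makes y the outer variable, where it can be substituted by \Po. *)
Definition straighten_poly : {poly {poly F}} -> L :=
  (@FracField.tofrac {poly k}) \o map_poly (@FracField.tofrac {poly F})
  \o swapXY \o comp_poly ('X * (1 - 'Y)) \o swapXY.

HB.instance Definition _ := GRing.RMorphism.on straighten_poly.

(** The substituted polynomial has degree 1 in the outer variable, and composition with a
    nonconstant polynomial kills no nonzero one. *)
Lemma straighten_poly_inj : injective straighten_poly.
Proof.
apply: raddf_inj => p /eqP; rewrite /straighten_poly /= tofrac_eq0.
have frac_inj : injective (@FracField.tofrac {poly F}).
  by move=> a b /eqP; rewrite tofrac_eq => /eqP.
rewrite -(rmorph0 (map_poly (@FracField.tofrac {poly F}))).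
rewrite (inj_eq (map_inj_poly frac_inj (rmorph0 _))) swapXY_eq0.
rewrite comp_poly2_eq0 ?swapXY_eq0 => [/eqP //|].
have -> : 1 - 'Y = (1 - 'X)%:P :> {poly {poly F}} by rewrite polyCB polyC1.
rewrite mulrC size_Cmul ?size_polyX //.
by rewrite subr_eq0 eq_sym -polyC1 -subr_eq0 polyXsubC_eq0.
Qed.

Definition straighten : K -> L := frac_lift straighten_poly_inj.

HB.instance Definition _ := GRing.RMorphism.on straighten.

Lemma straighten_tofrac p : straighten p%:F =
  (map_poly (@FracField.tofrac {poly F})
    (swapXY (swapXY p \Po ('X * (1 - 'Y)))))%:F.
Proof. exact: frac_lift_tofrac. Qed.

Lemma straighten_cst (c : F) : straighten c%:P%:P%:F = (c%:P%:F)%:P%:F.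
Proof.
rewrite straighten_tofrac swapXY_polyC map_polyC comp_polyC.
by rewrite swapXY_polyC /= !map_polyC.
Qed.

Lemma straighten_x : straighten 'X%:F = 'X%:F.
Proof.
rewrite straighten_tofrac swapXY_X comp_polyC swapXY_polyC.
by rewrite map_polyX map_polyX.
Qed.

Lemma straighten_y : straighten 'Y%:F = ('X%:F)%:P%:F * (1 - 'X%:F).
Proof.
rewrite straighten_tofrac swapXY_Y comp_polyX.
have -> : swapXY ('X * (1 - 'Y)) = 'Y * (1 - 'X) :> {poly {poly F}}.
  by rewrite rmorphM rmorphB rmorph1 /= swapXY_X swapXY_Y.
have -> : map_poly (@FracField.tofrac {poly F}) ('Y * (1 - 'X)) =
    ('X%:F)%:P * (1 - 'X).
  by rewrite rmorphM rmorphB rmorph1 /= map_polyC map_polyX.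
rewrite -tofrac1 -(tofracB (1 : {poly k}) 'X).
exact: (tofracM (('X%:F)%:P : {poly k}) (1 - 'X)).
Qed.

(** Comparison passes from the fraction field to the outer and then to the inner polynomial ring. It
    reduces the transport of [Dx] and [Dh] to constants, x and y. *)
Lemma ratfun_derivation_eq (M : fieldType) (f : {rmorphism K -> M})
    (d e : K -> M) :
  derivation f d -> derivation f e ->
  (forall c : F, d c%:P%:P%:F = e c%:P%:P%:F) ->
  d 'X%:F = e 'X%:F -> d 'Y%:F = e 'Y%:F -> d =1 e.
Proof.
case=> dD dM [eD eM] dc dX dY.
apply: (@frac_derivation_eq _ _ f); try by split.
apply: (@poly_derivation_eq _ _ (f \o @FracField.tofrac _)
  (d \o @FracField.tofrac _) (e \o @FracField.tofrac _)) => //.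
- by split=> a b /=; rewrite ?tofracD ?tofracM ?dD ?dM.
- by split=> a b /=; rewrite ?tofracD ?tofracM ?eD ?eM.
apply: (@poly_derivation_eq _ _ (f \o @FracField.tofrac _ \o polyC)
  (d \o @FracField.tofrac _ \o polyC) (e \o @FracField.tofrac _ \o polyC)) => //.
- by split=> a b /=; rewrite ?polyCD ?polyCM ?tofracD ?tofracM ?dD ?dM.
- by split=> a b /=; rewrite ?polyCD ?polyCM ?tofracD ?tofracM ?eD ?eM.
Qed.

End Straightening.

(** With y = u (1 - x) one has x + y - 1 = (1 - x) (u - 1), so 1 - x factors out. *)
Fact straight_int_factor (W : fieldType) (a b u x : W) :
  1 - x != 0 -> u != 0 -> u - 1 != 0 ->
  a / (u * (1 - x)) + b / (x + u * (1 - x) - 1) = (a / u + b / (u - 1)) / (1 - x).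
Proof.
move=> x0 u0 u1; have -> : x + u * (1 - x) - 1 = (1 - x) * (u - 1) by ring.
by field; rewrite x0 u0 u1.
Qed.

Fact inv_int_factor (W : fieldType) (a b x y : W) :
  y != 0 -> x + y - 1 != 0 ->
  (y * x + y ^+ 2 - y) / (a * x + a * y + b * y - a) =
  (a / y + b / (x + y - 1))^-1.
Proof.
move=> y0 z0; rewrite addf_div // invf_div; congr (_ / _); ring.
Qed.

(** This is the chain rule for y = u (1 - x) along a level curve: dy/dx = - u + (1 - x) du/dx, where
    du/dx = - (1 / x - (a + b) / (1 - x)) / g. *)
Fact straight_slope (W : fieldType) (a b u x g : W) :
  x != 0 -> 1 - x != 0 -> u != 0 -> u - 1 != 0 ->
  g = a / u + b / (u - 1) -> g != 0 ->
  - (x^-1 + b / (x + u * (1 - x) - 1)) / (g / (1 - x)) =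
  - u - (x^-1 - (a + b) / (1 - x)) * (g^-1 * (1 - x)).
Proof.
move=> x0 x1 u0 u1 gE g0; have -> : x + u * (1 - x) - 1 = (1 - x) * (u - 1) by ring.
(* Eliminating b / (u - 1) in favour of g lets g be treated as an independent variable. *)
have {}gE : b / (u - 1) = u * g - a - b by rewrite gE; field; rewrite u0 u1.
have -> : b / ((1 - x) * (u - 1)) = (u * g - a - b) / (1 - x).
  by rewrite -gE; field; rewrite x1 u1.
by field; rewrite x0 x1 g0.
Qed.

(** Here t stands for x^m, the letters with d and t prefixed are derivatives in x and under theta,
    and the two premises differentiate h q t = (1 - x)^2 p. The factor (1 - x)^2 turns the
    right-hand side into the single monomial r x^(m+1). *)
Fact pole_equation (W : fieldType) (x c r p q dp dq tp tq m t dh th : W) :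
  x != 0 -> 1 - x != 0 -> q != 0 -> t != 0 ->
  let h := (1 - x) ^+ 2 * p / (q * t) in
  dh * (q * t) + h * (dq * t + q * (m * t / x)) =
    - (1 - x) * p *+ 2 + (1 - x) ^+ 2 * dp ->
  th * (q * t) + h * (tq * t) = (1 - x) ^+ 2 * tp ->
  dh - (x^-1 - c / (1 - x)) * th = (1 - x) * r ->
  x * (1 - x) * (dp * q - p * dq) + (- m - (2 - m) * x) * p * q
    + (- (1 - (1 + c) * x)) * (tp * q - p * tq) = r * (x * t) * q ^+ 2.
Proof.
move=> x0 x1 q0 t0 h dhE thE E.
have {}dhE : dh = (- (1 - x) * p *+ 2 + (1 - x) ^+ 2 * dp
    - h * (dq * t + q * (m * t / x))) / (q * t).
  by rewrite -dhE addrK mulfK // mulf_neq0.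
have {}thE : th = ((1 - x) ^+ 2 * tp - h * (tq * t)) / (q * t).
  by rewrite -thE addrK mulfK // mulf_neq0.
have {}E : r = (dh - (x^-1 - c / (1 - x)) * th) / (1 - x).
  by rewrite E mulrC mulKf.
by rewrite E dhE thE /h; field; rewrite x0 x1 q0 t0.
Qed.

Lemma derivation_map_polyC (A : comNzRingType) (d : A -> A) a :
  derivation idfun d -> map_poly d a%:P = (d a)%:P.
Proof.
move=> /derivation0 d0; apply/polyP=> i.
by rewrite coef_map_id0 // !coefC; case: eqP.
Qed.

Lemma derivation_map_polyX (A : comNzRingType) (d : A -> A) :
  derivation idfun d -> map_poly d 'X = 0.
Proof.
move=> dP; have d0 := derivation0 dP; have d1 := derivation1 dP.
by apply/polyP=> i; rewrite coef_map_id0 // coefX coef0; case: eqP.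
Qed.


Section ChangeOfVariables.
Variables (K L : fieldType) (st : {rmorphism K -> L}).
Variables (dx dy : K -> K) (Ds Dt : L -> L).
Hypotheses (dxP : derivation idfun dx) (dyP : derivation idfun dy).
Hypotheses (DsP : derivation idfun Ds) (DtP : derivation idfun Dt).
Variables (e l m X Y : K) (a b x u g : L).
Hypotheses (eE : e = 1) (dxX : dx X = 1) (dxY : dx Y = 0).
Hypotheses (dyX : dy X = 0) (dyY : dy Y = 1).
Hypotheses (stl : st l = a) (stm : st m = b).
Hypotheses (stX : st X = x) (stY : st Y = u * (1 - x)).
Hypotheses (Dsx : Ds x = 1) (Dsu : Ds u = 0).
Hypotheses (Dtx : Dt x = 0) (Dtu : Dt u = g^-1).
Hypotheses (gE : g = a / u + b / (u - 1)) (g0 : g != 0).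
Hypotheses (x0 : x != 0) (x1 : 1 - x != 0) (u0 : u != 0) (u1 : u - 1 != 0).

(** The unfolded [dlog d] of [F10], with e, l, m the coefficients of the three logarithms. *)
Local Notation dlogF d :=
  (e * (d X / X) + (l * (d Y / Y) + (m * (d (X + Y - 1) / (X + Y - 1)) + 0))).

Fact dlog_dyE : dlogF dy = l / Y + m / (X + Y - 1).
Proof.
rewrite (derivationB dyP) (derivation_add dyP) (derivation1 dyP) dyX dyY.
by rewrite eE subr0 add0r addr0 !mul0r !mul1r add0r.
Qed.

Fact dlog_dxE : dlogF dx = X^-1 + m / (X + Y - 1).
Proof.
rewrite (derivationB dxP) (derivation_add dxP) (derivation1 dxP) dxX dxY.
by rewrite eE subr0 !addr0 !mul0r !mul1r mulr0 add0r.
Qed.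

Fact st_int_factor : st (dlogF dy) = g / (1 - x).
Proof.
rewrite dlog_dyE rmorphD !fmorph_div rmorphB rmorphD rmorph1.
by rewrite stl stm stX stY gE straight_int_factor.
Qed.

(** This and the next facts verify the transport of both derivations on the generators: constants, x
    and y. *)
Fact st_Dh_const c v : dy c = 0 -> st c = v -> Dt v = 0 ->
  st ((dlogF dy)^-1 * dy c) = Dt (st c).
Proof. by move=> dc -> ->; rewrite dc mulr0 rmorph0. Qed.

Fact st_Dx_const c v r s : dx c = 0 -> dy c = 0 -> st c = v ->
  Ds v = 0 -> Dt v = 0 -> st (dx c + r * dy c) = Ds (st c) + s * Dt (st c).
Proof.
by move=> xc yc -> -> ->; rewrite xc yc !mulr0 !addr0 rmorph0.
Qed.

Fact st_Dh_x : st ((dlogF dy)^-1 * dy X) = Dt (st X).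
Proof. by rewrite rmorphM dyX rmorph0 mulr0 stX Dtx. Qed.

Fact st_Dh_y : st ((dlogF dy)^-1 * dy Y) = Dt (st Y).
Proof.
rewrite rmorphM fmorphV st_int_factor dyY rmorph1 mulr1 stY.
rewrite (derivation_mul DtP) (derivationB DtP) (derivation1 DtP).
by rewrite Dtx Dtu subr0 mulr0 addr0 invf_div mulrC.
Qed.

Fact st_Dx_x : st (dx X + - dlogF dx / dlogF dy * dy X) =
  Ds (st X) + - (x^-1 - (a + b) / (1 - x)) * Dt (st X).
Proof.
by rewrite rmorphD rmorphM dyX dxX rmorph0 rmorph1 stX Dsx Dtx !mulr0 !addr0.
Qed.

Fact st_Dx_y : st (dx Y + - dlogF dx / dlogF dy * dy Y) =
  Ds (st Y) + - (x^-1 - (a + b) / (1 - x)) * Dt (st Y).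
Proof.
rewrite rmorphD rmorphM fmorph_div rmorphN st_int_factor dlog_dxE.
rewrite dyY dxY rmorph0 rmorph1 mulr1 add0r rmorphD fmorph_div fmorphV.
rewrite rmorphB rmorphD rmorph1 stm stX stY.
rewrite (derivation_mul DtP) (derivationB DtP) (derivation1 DtP) Dtx Dtu.
rewrite (derivation_mul DsP) (derivationB DsP) (derivation1 DsP) Dsx Dsu.
rewrite subr0 mulr0 addr0 mul0r !add0r mulrN1 [X in _ = _ + X]mulNr.
exact: straight_slope.
Qed.

Fact st_integrand :
  st ((Y * X + Y ^+ 2 - Y) / (l * X + l * Y + m * Y - l)) = (1 - x) * g^-1.
Proof.
rewrite inv_int_factor.
- by rewrite -dlog_dyE fmorphV st_int_factor invf_div.
- by rewrite -(fmorph_eq0 st) stY mulf_neq0.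
rewrite -(fmorph_eq0 st) rmorphB rmorphD rmorph1 stX stY.
have -> : x + u * (1 - x) - 1 = (1 - x) * (u - 1) by ring.
by rewrite mulf_neq0.
Qed.

Variables (k : fieldType) (theta : k -> k) (iota : {rmorphism k -> L}).
Hypothesis Dt_iota : forall v, Dt (iota v) = iota (theta v).

(** A factor w killed by [Dt] passes through every iterate, leaving powers of theta on k. *)
Fact st_sum (Dh : K -> K) (w : L) G v n (q : nat -> K) (c : nat -> k) :
  (forall P, st (Dh P) = Dt (st P)) -> Dt w = 0 -> st G = w * iota v ->
  (forall i, st (q i) = iota (c i)) ->
  st (\sum_(i < n) q i * iter i Dh G) =
  w * iota (\sum_(i < n) c i * iter i theta v).
Proof.
move=> stD w0 stG stq; rewrite !rmorph_sum mulr_sumr; apply: eq_bigr => i _.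
rewrite !rmorphM stq mulrCA; congr (_ * _).
elim: (nat_of_ord i) => //= j IH.
by rewrite stD IH (derivation_mul DtP) w0 mul0r add0r Dt_iota.
Qed.

End ChangeOfVariables.

Fact rmorph_log_slope (W W' : fieldType) (h : {rmorphism W -> W'}) a b u :
  h (a / u + b / (u - 1)) = h a / h u + h b / (h u - 1).
Proof. by rewrite rmorphD !fmorph_div rmorphB rmorph1. Qed.

Fact rmorph_sub1_neq0 (W W' : fieldType) (h : {rmorphism W -> W'}) u :
  u - 1 != 0 -> h u - 1 != 0.
Proof. by rewrite -(fmorph_eq0 h) rmorphB rmorph1. Qed.

Section FractionConst.
Variable F : idomainType.
Local Notation k := {fraction {poly F}}.
Definition fraction_const : k -> {fraction {poly k}} :=
  @FracField.tofrac {poly k} \o polyC.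
HB.instance Definition _ := GRing.RMorphism.on fraction_const.
End FractionConst.

(** * The telescoper equation in the coordinates x and u *)

Section Telescoper.
Variables (R : realType) (lambda mu : R[i]).
Local Notation C := R[i].
Local Notation k := {fraction {poly C}}.
Local Notation L := {fraction {poly k}}.
Local Notation const c := (c%:P%:F : k).
Local Notation iota := (@fraction_const C).
Local Notation u := ('X%:F : k).
Local Notation x := ('X%:F : L).
Local Notation f := (F10 lambda mu).
Local Notation st := (@straighten C).

(* The derivative in u of lambda ln u + mu ln (u - 1). *)
Definition log_slope : k := const lambda / u + const mu / (u - 1).
Local Notation gamma := log_slope.

Definition theta (v : k) : k := gamma^-1 * frac_deriv (@deriv C) v.

(* The derivatives with respect to x at constant u, and h at constant x. *)
Definition Ds : L -> L := frac_deriv (@deriv k).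
Definition Dt : L -> L := frac_deriv (map_poly theta).

Lemma theta_derivation : derivation idfun theta.
Proof. exact/derivation_scale/frac_deriv_derivation/deriv_derivation. Qed.

Lemma Ds_derivation : derivation idfun Ds.
Proof. exact/frac_deriv_derivation/deriv_derivation. Qed.

Lemma Dt_derivation : derivation idfun Dt.
Proof. exact/frac_deriv_derivation/map_poly_derivation/theta_derivation. Qed.

Lemma theta_const c : theta (const c) = 0.
Proof.
rewrite /theta frac_deriv_tofrac; last exact: deriv_derivation.
by rewrite derivC tofrac0 mulr0.
Qed.

Lemma theta_u : theta u = gamma^-1.
Proof.
rewrite /theta frac_deriv_tofrac; last exact: deriv_derivation.
by rewrite derivX tofrac1 mulr1.
Qed.

Lemma Ds_tofrac p : Ds p%:F = p^`()%:F.
Proof. by rewrite /Ds frac_deriv_tofrac //; exact: deriv_derivation. Qed.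

Lemma Dt_tofrac p : Dt p%:F = (map_poly theta p)%:F.
Proof.
rewrite /Dt frac_deriv_tofrac //.
exact/map_poly_derivation/theta_derivation.
Qed.

Lemma Ds_iota v : Ds (iota v) = 0.
Proof. by rewrite [LHS]Ds_tofrac derivC tofrac0. Qed.

Lemma Dt_iota v : Dt (iota v) = iota (theta v).
Proof.
by rewrite [LHS]Dt_tofrac (derivation_map_polyC _ theta_derivation).
Qed.

Lemma Ds_x : Ds x = 1.
Proof. by rewrite Ds_tofrac derivX tofrac1. Qed.

Lemma Dt_const c : Dt (iota (const c)) = 0.
Proof. by rewrite Dt_iota theta_const rmorph0. Qed.

Lemma Dt_x : Dt x = 0.
Proof.
by rewrite Dt_tofrac (derivation_map_polyX theta_derivation) tofrac0.
Qed.

Lemma u_neq0 : u != 0.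
Proof. by rewrite tofrac_eq0 polyX_eq0. Qed.

Lemma u1_neq0 : u - 1 != 0.
Proof. by rewrite -tofrac1 -tofracB tofrac_eq0 -polyC1 polyXsubC_eq0. Qed.

Lemma x_neq0 : x != 0.
Proof. by rewrite tofrac_eq0 polyX_eq0. Qed.

Lemma x1_neq0 : 1 - x != 0.
Proof.
by rewrite subr_eq0 eq_sym -subr_eq0 -tofrac1 -tofracB tofrac_eq0 -polyC1 polyXsubC_eq0.
Qed.

Lemma dx_derivation : derivation idfun (@dx R).
Proof. exact/frac_deriv_derivation/deriv_derivation. Qed.

Lemma dy_derivation : derivation idfun (@dy R).
Proof.
exact/frac_deriv_derivation/map_poly_derivation/deriv_derivation.
Qed.

Lemma dx_tofrac p : dx p%:F = p^`()%:F :> {fraction {poly {poly C}}}.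
Proof. by rewrite /dx frac_deriv_tofrac //; exact: deriv_derivation. Qed.

Lemma dy_tofrac p :
  dy p%:F = (map_poly (@deriv C) p)%:F :> {fraction {poly {poly C}}}.
Proof.
rewrite /dy frac_deriv_tofrac //.
exact/map_poly_derivation/deriv_derivation.
Qed.

Lemma dx_cst c : dx (cst c : {fraction {poly {poly C}}}) = 0.
Proof. by rewrite dx_tofrac derivC tofrac0. Qed.

Lemma dx_fx : dx (fx R) = 1.
Proof. by rewrite dx_tofrac derivX tofrac1. Qed.

Lemma dx_fy : dx (fy R) = 0.
Proof. by rewrite dx_tofrac derivC tofrac0. Qed.

Lemma dy_cst c : dy (cst c : {fraction {poly {poly C}}}) = 0.
Proof.
by rewrite dy_tofrac (derivation_map_polyC _ (deriv_derivation C)) derivC tofrac0.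
Qed.

Lemma dy_fx : dy (fx R) = 0.
Proof.
by rewrite dy_tofrac (derivation_map_polyX (deriv_derivation C)) tofrac0.
Qed.

Lemma dy_fy : dy (fy R) = 1.
Proof.
rewrite dy_tofrac (derivation_map_polyC _ (deriv_derivation C)) derivX.
by rewrite polyC1 tofrac1.
Qed.

Lemma st_cst c : st (cst c) = iota (const c).
Proof. exact: straighten_cst. Qed.
Lemma st_x : st (fx R) = x.
Proof. exact: straighten_x. Qed.
Lemma st_y : st (fy R) = iota u * (1 - x).
Proof. exact: straighten_y. Qed.

Hypothesis gamma_neq0 : gamma != 0.

Lemma iota_gamma : iota gamma =
  iota (const lambda) / iota u + iota (const mu) / (iota u - 1).
Proof. exact: rmorph_log_slope. Qed.

Lemma iota_neq0 v : v != 0 -> iota v != 0.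
Proof. by rewrite fmorph_eq0. Qed.

Lemma iota_u1_neq0 : iota u - 1 != 0.
Proof. exact: (rmorph_sub1_neq0 _ u1_neq0). Qed.

Lemma Dt_iota_u : Dt (iota u) = (iota gamma)^-1.
Proof.
by rewrite Dt_iota theta_u fmorphV.
Qed.

Lemma cst1 : cst 1 = 1 :> {fraction {poly {poly C}}}.
Proof. by rewrite /cst !polyC1 tofrac1. Qed.

Lemma dlogE d : dlog d f =
  cst 1 * (d (fx R) / fx R) + (cst lambda * (d (fy R) / fy R)
  + (cst mu * (d (fx R + fy R - 1) / (fx R + fy R - 1)) + 0)).
Proof. by rewrite /dlog !big_cons big_nil. Qed.

Lemma st_Dh P : st (Dh f P) = Dt (st P).
Proof.
apply: (@ratfun_derivation_eq _ _ st (st \o Dh f) (Dt \o st)).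
- exact/derivation_comp_r/derivation_scale/dy_derivation.
- exact/derivation_comp_l/Dt_derivation.
- move=> c; rewrite /comp /Dh /int_factor dlogE.
  exact: (st_Dh_const (cst 1) (cst lambda) (cst mu) (fx R) (fy R) (dy_cst c) (st_cst c) (Dt_const c)).
- rewrite /comp /Dh /int_factor dlogE.
  exact: (st_Dh_x (cst 1) (cst lambda) (cst mu) (fy R) dy_fx st_x Dt_x).
rewrite /comp /Dh /int_factor dlogE.
exact: (st_Dh_y dy_derivation Dt_derivation cst1 dy_fx dy_fy (st_cst _)
  (st_cst _) st_x st_y Dt_x Dt_iota_u iota_gamma x1_neq0
  (iota_neq0 u_neq0) iota_u1_neq0).
Qed.

Local Notation c0 := (const lambda + const mu).

(** Raising x at constant u raises h at the rate 1 / x - (lambda + mu) / (1 - x); staying on the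
    level curve subtracts this multiple of the derivative in h. *)
Lemma st_Dx P : st (Dx f P) =
  Ds (st P) + - (x^-1 - (iota (const lambda) + iota (const mu)) / (1 - x)) * Dt (st P).
Proof.
apply: (@ratfun_derivation_eq _ _ st (st \o Dx f)
  (fun P => Ds (st P)
     + - (x^-1 - (iota (const lambda) + iota (const mu)) / (1 - x)) * Dt (st P))).
- apply/derivation_comp_r/derivation_scale_add; first exact: dx_derivation.
  exact: dy_derivation.
- apply: derivation_scale_add.
    exact/derivation_comp_l/Ds_derivation.
  exact/derivation_comp_l/Dt_derivation.
- move=> c; rewrite [LHS]/comp /Dx.
  exact: (st_Dx_const _ _ (dx_cst c) (dy_cst c) (st_cst c) (Ds_iota _)
    (Dt_const c)).
- rewrite [LHS]/comp /Dx /slope !dlogE.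
  exact: (st_Dx_x (cst 1) (cst lambda) (cst mu) (fy R)
    (iota (const lambda)) (iota (const mu)) dx_fx dy_fx st_x Ds_x Dt_x).
rewrite [LHS]/comp /Dx /slope !dlogE.
exact: (st_Dx_y dx_derivation dy_derivation Ds_derivation Dt_derivation cst1
  dx_fx dx_fy dy_fx dy_fy (st_cst _) (st_cst _) st_x st_y Ds_x (Ds_iota _) Dt_x
  Dt_iota_u iota_gamma (iota_neq0 gamma_neq0) x_neq0 x1_neq0
  (iota_neq0 u_neq0) iota_u1_neq0).
Qed.

Lemma Dt_x1 : Dt (1 - x) = 0.
Proof.
by rewrite (derivationB Dt_derivation) (derivation1 Dt_derivation) Dt_x subrr.
Qed.

Lemma st_G : st (G10 lambda mu) = (1 - x) * fraction_const gamma^-1.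
Proof.
rewrite fmorphV -[G10 _ _]/((fy R * fx R + fy R ^+ 2 - fy R) /
  (cst lambda * fx R + cst lambda * fy R + cst mu * fy R - cst lambda)).
exact: (st_integrand dy_derivation cst1 dy_fx dy_fy (st_cst _) (st_cst _)
  st_x st_y iota_gamma x1_neq0 (iota_neq0 u_neq0) iota_u1_neq0).
Qed.

Lemma straightened_telescoper : has_telescoper f (G10 lambda mu) ->
  exists (a : {poly C}) (h : L), a != 0 /\
    Ds h - (x^-1 - iota c0 / (1 - x)) * Dt h =
    (1 - x) * iota (\sum_(i < size a) const a`_i * iter i theta gamma^-1).
Proof.
case=> a [H [a0 E]]; exists a, (st H); split=> //.
rewrite rmorphD -mulNr -st_Dx E.
exact: (@st_sum _ _ st _ Dt_derivation _ _ iota Dt_iota _ _ _ _ _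
  (fun i => cst a`_i) (fun i => const a`_i) st_Dh Dt_x1 st_G
  (fun i => st_cst _)).
Qed.

End Telescoper.

(** * From a rational certificate to the first order equation *)

Fact pole_equation_deriv (L : fieldType) (Ds Dt : L -> L) (x c r p q h : L) m :
  derivation idfun Ds -> derivation idfun Dt -> Ds x = 1 -> Dt x = 0 ->
  x != 0 -> 1 - x != 0 -> q != 0 -> h * (q * x ^+ m) = (1 - x) ^+ 2 * p ->
  Ds h - (x^-1 - c / (1 - x)) * Dt h = (1 - x) * r ->
  x * (1 - x) * (Ds p * q - p * Ds q) + (- m%:R - (2 - m%:R) * x) * p * q
    + (- (1 - (1 + c) * x)) * (Dt p * q - p * Dt q) = r * (x * x ^+ m) * q ^+ 2.
Proof.
move=> DsP DtP Dsx Dtx x0 x1 q0 hE E.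
have t0 : x ^+ m != 0 by rewrite expf_neq0.
have Dst : Ds (x ^+ m) = m%:R * x ^+ m / x.
  rewrite (derivationX DsP) Dsx mulr1 /= -mulr_natl.
  by case: (m) => [|n]; rewrite ?mul0r // exprS -mulrA [x * _]mulrC mulfK.
have Dtt : Dt (x ^+ m) = 0 by rewrite (derivationX DtP) Dtx mulr0 mul0rn.
have Ds1x : Ds (1 - x) = -1.
  by rewrite (derivationB DsP) (derivation1 DsP) Dsx sub0r.
have Dt1x : Dt (1 - x) = 0.
  by rewrite (derivationB DtP) (derivation1 DtP) Dtx subrr.
have hE' : h = (1 - x) ^+ 2 * p / (q * x ^+ m).
  by rewrite -hE mulfK // mulf_neq0.
apply: (pole_equation x0 x1 q0 t0 _ _ E).
  have /(congr1 Ds) := hE; rewrite !(derivation_mul DsP) /= Dst Ds1x -hE' => ->.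
  ring.
have /(congr1 Dt) := hE; rewrite !(derivation_mul DtP) /= Dtt Dt1x -hE'.
by rewrite mulr0 addr0 => ->; ring.
Qed.

Lemma rational_solution_exact (k : fieldType) (theta : k -> k)
    (h : {fraction {poly k}}) (c r : k) (N : nat) :
  derivation idfun theta -> theta c = 0 -> (0 < N)%N ->
  (forall n : nat, n.+1%:R != 0 :> k) ->
  (forall n : nat, (1 + c) * N%:R != n%:R) ->
  frac_deriv (@deriv k) h
  - ('X%:F^-1 - c%:P%:F / (1 - 'X%:F)) * frac_deriv (map_poly theta) h =
    (1 - 'X%:F) * r%:P%:F ->
  twisted_exact theta N%:R r.
Proof.
move=> thetaP c0 N0 char0 cN E.
have [A [B [B0 hE]]] := fracP h.
have X1 : 1 - 'X != 0 :> {poly k}.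
  by rewrite -opprB oppr_eq0 -polyC1 polyXsubC_eq0.
(* This gives h = (1 - x)^2 A / (Q x^m) with Q(0) nonzero. A and B need not be coprime, so m only
   bounds the order of the pole of h at 0. *)
have [m [Q]] := multiplicity_XsubC (B * (1 - 'X) ^+ 2) 0.
rewrite mulf_neq0 ?expf_neq0 //= subr0 rootE => Q0 BE.
have Qn0 : Q != 0 by apply: contraNneq Q0 => ->; rewrite horner0.
have dP := deriv_derivation k; have mP := map_poly_derivation thetaP.
apply: (@obstruction _ _ thetaP A Q c r m) => //.
have tx : 1 - 'X%:F = (1 - 'X)%:F :> {fraction {poly k}}.
  by rewrite tofracB tofrac1.
have Y := @pole_equation_deriv _ (frac_deriv (@deriv k))
  (frac_deriv (map_poly theta)) 'X%:F c%:P%:F r%:P%:F A%:F Q%:F h m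
  (frac_deriv_derivation dP) (frac_deriv_derivation mP).
move: Y; rewrite !(frac_deriv_tofrac dP) !(frac_deriv_tofrac mP).
rewrite derivX (derivation_map_polyX thetaP).
move=> /(_ (tofrac1 _) (tofrac0 _)); rewrite {1}tx !tofrac_eq0 polyX_eq0.
move=> /(_ isT X1 Qn0) /(_ _ E) H.
apply/eqP; rewrite -tofrac_eq; apply/eqP.
rewrite exprS.
have nE n : n%:R%:F = n%:R :> {fraction {poly k}} by exact: rmorph_nat.
rewrite !(tofracD, tofracM, tofracN, tofracXn, tofrac1, nE).
apply: H; rewrite tx hE -!tofracXn -[Q%:F * _]tofracM -['X^m]/('X ^+ m) -BE.
rewrite tofracM mulrA divfK ?tofrac_eq0 //; exact: mulrC.
Qed.

(** Modulo the image of theta - r, a polynomial in theta with constant coefficients acts as its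
    value at r. *)
Lemma sum_iter_twisted_exact (k : fieldType) (theta : k -> k) (r f : k) n
    (c : nat -> k) :
  derivation idfun theta -> theta r = 0 -> (forall i, theta (c i) = 0) ->
  twisted_exact theta r (\sum_(i < n) c i * iter i theta f) ->
  twisted_exact theta r ((\sum_(i < n) c i * r ^+ i) * f).
Proof.
move=> thetaP r0 c0 ex.
have -> : (\sum_(i < n) c i * r ^+ i) * f =
    \sum_(i < n) c i * iter i theta f
    + -1 * \sum_(i < n) c i * (iter i theta f - r ^+ i * f).
  rewrite mulN1r -sumrB mulr_suml; apply: eq_bigr => i _; ring.
have th1 := derivation1 thetaP.
apply: (twisted_exactD thetaP ex); apply: (twisted_exactZ thetaP).
  by rewrite (derivationN thetaP) th1 oppr0.
apply: (big_ind (twisted_exact theta r)) => [|a b|i _].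
- by exists 0; rewrite (derivation0 thetaP) mulr0 subrr.
- exact: twisted_exactD.
by apply: (twisted_exactZ thetaP) => //; exact: iter_twisted_exact.
Qed.

Section Constants.
Variable F : idomainType.

Lemma const_sum_horner (a : {poly F}) (N : nat) :
  \sum_(i < size a) (a`_i)%:P%:F * N%:R ^+ i =
  (a.[N%:R])%:P%:F :> {fraction {poly F}}.
Proof.
rewrite horner_coef !rmorph_sum; apply: eq_bigr => i _.
by rewrite /= polyCM tofracM polyC_exp tofracXn polyC_natr rmorph_nat.
Qed.

End Constants.

Fact undo_scaling (W : fieldType) (g n w' w : W) :
  g != 0 -> g^-1 = g^-1 * w' - n * w -> w' - n * g * w = 1.
Proof.
move=> g0 E; rewrite -(mulfV g0) E mulrBr mulrA mulfV // mul1r; ring.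
Qed.

(** Multiplying 1 / g = theta w - N w by g gives w' - N g w = 1, which is excluded by [rational_ode]
    with parameters N a and N b. *)
Lemma inv_log_slope_not_exact (F : numClosedFieldType) (a b : F) (N : nat)
    (w : {fraction {poly F}}) :
  let g := a%:P%:F / 'X%:F + b%:P%:F / ('X%:F - 1) in
  (forall n : nat, N%:R * a + n%:R != 0) ->
  (forall n : nat, N%:R * b + n%:R != 0) ->
  (forall n : nat, N%:R * a + N%:R * b != n%:R) ->
  g != 0 /\ g^-1 != g^-1 * frac_deriv (@deriv F) w - N%:R * w.
Proof.
move=> g aN bN abN; have ode := rational_ode aN bN abN.
have cE c : (N%:R * c)%:P%:F = N%:R * c%:P%:F :> {fraction {poly F}}.
  by rewrite polyCM tofracM polyC_natr; congr (_ * _); exact: rmorph_nat.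
have gE : (N%:R * a)%:P%:F / 'X%:F + (N%:R * b)%:P%:F / ('X%:F - 1) = N%:R * g.
  by rewrite !cE -!mulrA -mulrDr.
have g0 : g != 0.
  (* If g were 0, then v = u would solve the equation, which would read v' = 1. *)
  apply: contraNneq (ode 'X%:F) => g0; rewrite gE g0 mulr0 mul0r subr0.
  rewrite frac_deriv_tofrac; last exact: deriv_derivation.
  by rewrite derivX tofrac1.
split=> //; apply: contraNneq (ode w) => E; rewrite gE.
by apply/eqP; exact: undo_scaling.
Qed.

Theorem proposition8 (R : realType) (schanuel : schanuel_conjecture R)
    (lambda mu : R[i])
    (lambda_alg : algebraic_number lambda) (mu_alg : algebraic_number mu)
    (indep : lin_indepQ [tuple 1; lambda; mu]) :
  ~ has_telescoper (F10 lambda mu) (G10 lambda mu).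
Proof.
have lin (p q r : rat) :
    ratr p + ratr q * lambda + ratr r * mu = 0 -> [/\ p = 0, q = 0 & r = 0].
  move=> E; have := indep (fun i => nth 0 [:: p; q; r] i).
  rewrite !big_ord_recl big_ord0 !(tnth_nth 0) /= mulr1 addr0 addrA => /(_ E) H.
  have q0 := H (inord 1); have r0 := H (inord 2).
  by rewrite !inordK in q0 r0; split=> //; exact: H ord0.
(* N names a nonzero coefficient of lambda or of mu, which makes the relation nontrivial. *)
have not_rel (N l m n : rat) : N != 0 ->
    (N = l) \/ (N = m) -> ratr n + ratr l * lambda + ratr m * mu != 0.
  move=> N0 Nlm; apply/eqP => /lin [_ l0 m0].
  by case: Nlm => NE; move: N0; rewrite NE ?l0 ?m0 eqxx.
move=> tel.
have natQ n : ratr n%:R = n%:R :> R[i] by rewrite ratr_nat.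
have lN N n : (0 < N)%N -> N%:R * lambda + n%:R != 0.
  rewrite lt0n -(@pnatr_eq0 rat) => N0.
  have := not_rel _ _ 0 n%:R N0 (or_introl erefl).
  by rewrite rmorph0 mul0r addr0 !natQ addrC.
have mN N n : (0 < N)%N -> N%:R * mu + n%:R != 0.
  rewrite lt0n -(@pnatr_eq0 rat) => N0.
  have := not_rel _ 0 _ n%:R N0 (or_intror erefl).
  by rewrite rmorph0 mul0r addr0 !natQ addrC.
have lmN N n : (0 < N)%N -> N%:R * lambda + N%:R * mu != n%:R.
  rewrite lt0n -(@pnatr_eq0 rat) => N0.
  have := not_rel _ N%:R N%:R (- n%:R) N0 (or_introl erefl).
  by rewrite rmorphN /= !natQ -addrA addrC subr_eq0.
have slopeP N w (N0 : (0 < N)%N) := @inv_log_slope_not_exact _ lambda mu N w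
  (fun n => lN N n N0) (fun n => mN N n N0) (fun n => lmN N n N0).
(* Nonvanishing of the slope involves neither N nor w; 1 and 0 are arbitrary choices. *)
have g0 : log_slope lambda mu != 0 by case: (slopeP 1 0 isT).
have [a [h [a0 E]]] := straightened_telescoper g0 tel.
have [N N0 aN] := exists_nat_nonroot a0.
have thP := theta_derivation lambda mu.
have thc c := theta_const lambda mu c.
have cE (c d : R[i]) :
    (c%:P%:F == d%:P%:F :> {fraction {poly R[i]}}) = (c == d).
  by rewrite tofrac_eq (inj_eq (@polyC_inj _)).
have natE n : n%:R = (n%:R : R[i])%:P%:F :> {fraction {poly R[i]}}.
  by rewrite polyC_natr rmorph_nat.
have c0 : theta lambda mu (lambda%:P%:F + mu%:P%:F) = 0.
  by rewrite (derivation_add thP) !thc addr0.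
have nat_neq0 n : n.+1%:R != 0 :> {fraction {poly R[i]}}.
  by rewrite natE -tofrac0 -polyC0 cE pnatr_eq0.
have cN n : (1 + (lambda%:P%:F + mu%:P%:F)) * N%:R != n%:R
    :> {fraction {poly R[i]}}.
  rewrite !natE -tofrac1 -polyC1 -!tofracD -!polyCD -tofracM -polyCM.
  rewrite cE; have N0' : N%:R != 0 :> rat by rewrite pnatr_eq0 -lt0n.
  (* Equality would be the rational relation (N - n) + N lambda + N mu = 0. *)
  have := not_rel _ N%:R N%:R (N%:R - n%:R) N0' (or_introl erefl).
  rewrite rmorphB /= !natQ; apply: contra_neq => nE.
  by rewrite -nE; ring.
have exS := rational_solution_exact thP c0 N0 nat_neq0 cN E.
have {}exS := sum_iter_twisted_exact thP (derivation_nat thP N)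
  (fun i => thc a`_i) exS.
rewrite const_sum_horner in exS.
(* The factor a(N) is a nonzero constant, so 1 / gamma itself is in the image of theta - N. *)
have [|w wE] := twisted_exactZ_inv thP (thc _) _ exS.
  by rewrite -tofrac0 -polyC0 cE.
have [_ /eqP] := slopeP N w N0; exact.
Qed.
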